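(* Let $\mathcal{P}_v$ be the set of vectors ($\Re$-equivalence classes of arrows) of an arrow space $\mathcal{P}_A$ satisfying Axioms 1, 2, 4, 5 stated in the context. For any $[\overrightarrow{AB}]\in\mathcal{P}_v$ and $s,t\in\mathbb{R}$: (1) $(ts)\,[\overrightarrow{AB}]=t\,[(s)\overrightarrow{AB}]$; (2) $(t+s)\,[\overrightarrow{AB}]=t\,[\overrightarrow{AB}]+_V s\,[\overrightarrow{AB}]$.
   Context: Let $\mathcal{P}$ be an infinite set whose elements are called points. An arrow is an ordered pair of points $\overrightarrow{AB}=(A,B)$ (tail $A$, head $B$; $A=B$ is allowed). The arrow space $\mathcal{P}_A$ is the set of all arrows; two arrows are equal iff they have the same tail and the same head. Negation: $-\overrightarrow{AB}=\overrightarrow{BA}$. Arrow addition is the partial operation $\overrightarrow{AB}+_A\overrightarrow{BC}=\overrightarrow{AC}$, defined exactly when the head of the first arrow equals the tail of the second. Axiom 1: there is a given map (arrow pre-inner product) $\langle -,-\rangle_A:\mathcal{P}_A\times\mathcal{P}_A\to\mathbb{R}$ such that for all points: $\langle\overrightarrow{AB},\overrightarrow{AB}\rangle_A\ge 0$, with equality iff $A=B$; $\langle\overrightarrow{AB},\overrightarrow{CD}\rangle_A=\langle\overrightarrow{CD},\overrightarrow{AB}\rangle_A$; $\langle\overrightarrow{AB}+_A\overrightarrow{BC},\overrightarrow{LM}\rangle_A=\langle\overrightarrow{AB},\overrightarrow{LM}\rangle_A+\langle\overrightarrow{BC},\overrightarrow{LM}\rangle_A$; $\langle-\overrightarrow{AB},\overrightarrow{CD}\rangle_A=-\langle\overrightarrow{AB},\overrightarrow{CD}\rangle_A$.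 Measure: $\|\overrightarrow{AB}\|_A=\sqrt{\langle\overrightarrow{AB},\overrightarrow{AB}\rangle_A}$. Scalar multiplication of arrows: for $t\in\mathbb{R}$, if $A=B$ or $t=0$ then $(t)\overrightarrow{AB}=\overrightarrow{AA}$. If $A\ne B$ and $t\neq0$ then $(t)\overrightarrow{AB}=\overrightarrow{AD}$, where $D\in\mathcal{P}$ is a point (assumed to exist) with $\|\overrightarrow{AD}\|_A=|t|\,\|\overrightarrow{AB}\|_A$ and $\langle\overrightarrow{AB},\overrightarrow{AD}\rangle_A=\|\overrightarrow{AB}\|_A\|\overrightarrow{AD}\|_A$ if $t>0$, $=-\|\overrightarrow{AB}\|_A\|\overrightarrow{AD}\|_A$ if $t<0$. Axiom 2: $\langle(t)\overrightarrow{AB},\overrightarrow{CD}\rangle_A=t\langle\overrightarrow{AB},\overrightarrow{CD}\rangle_A$ for all arrows and all $t\in\mathbb{R}$. Relation $\Re$ on $\mathcal{P}_A$: $\overrightarrow{AB}\;\Re\;\overrightarrow{CD}$ iff either $A=B$ and $C=D$, or ($A\ne B$, $C\neq D$ and) $\|\overrightarrow{AB}\|_A=\|\overrightarrow{CD}\|_A$ and $\frac{\langle\overrightarrow{AB},\overrightarrow{CD}\rangle_A}{\|\overrightarrow{AB}\|_A\|\overrightarrow{CD}\|_A}=1$. Axiom 4: if $\overrightarrow{AB}\;\Re\;\overrightarrow{CD}$ and $\overrightarrow{EF}\;\Re\;\overrightarrow{GH}$, then $\langle\overrightarrow{AB},\overrightarrow{EF}\rangle_A=\langle\overrightarrow{CD},\overrightarrow{GH}\rangle_A$.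 (Then $\Re$ is an equivalence relation.) Axiom 5: for $A\neq B$ and any point $P$, there is a unique point $K$ with $\overrightarrow{AB}\;\Re\;\overrightarrow{PK}$ and a unique point $K'$ with $\overrightarrow{AB}\;\Re\;\overrightarrow{K'P}$. (For $A=B$ the same holds with $K=K'=P$.) Vectors: $\mathcal{P}_v$ is the set of $\Re$-equivalence classes $[\overrightarrow{AB}]$. Vector addition: given $[\overrightarrow{AB}],[\overrightarrow{CD}]$, choose any point $P$, let $K,L$ be the unique points with $\overrightarrow{KP}\;\Re\;\overrightarrow{AB}$ and $\overrightarrow{PL}\;\Re\;\overrightarrow{CD}$, and set $[\overrightarrow{AB}]+_V[\overrightarrow{CD}]=[\overrightarrow{KP}+_A\overrightarrow{PL}]=[\overrightarrow{KL}]$; this is well defined (independent of $P$ and of the representatives). Vector scalar multiplication: $t\,[\overrightarrow{AB}]=[(t)\overrightarrow{AB}]$, also independent of the representative. *)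

(* Defs.v *)
From mathcomp Require Import all_boot all_order all_algebra.
From mathcomp Require Import boolp classical_sets cardinality reals.

Set Implicit Arguments.
Unset Strict Implicit.
Unset Printing Implicit Defensive.

Import Order.TTheory GRing.Theory Num.Theory.
Local Open Scope classical_set_scope.
Local Open Scope ring_scope.

Definition arrow (P : Type) : Type := (P * P)%type.

Definition arrow_tail {P : Type} (a : arrow P) : P := a.1.

Definition arrow_head {P : Type} (a : arrow P) : P := a.2.

Definition arrow_opp {P : Type} (a : arrow P) : arrow P :=
  (arrow_head a, arrow_tail a).

(* The partiality of the addition is carried by the proof argument. *)
Definition arrow_add {P : Type} (a b : arrow P)
  (_ : arrow_head a = arrow_tail b) : arrow P := (arrow_tail a, arrow_head b).

Definition measure_of {R : realType} {P : Type} (ip : arrow P -> arrow P -> R)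
  (a : arrow P) : R := Num.sqrt (ip a a).

Definition arrow_rel {R : realType} {P : Type} (ip : arrow P -> arrow P -> R)
    (a b : arrow P) : Prop :=
  (arrow_tail a = arrow_head a /\ arrow_tail b = arrow_head b) \/
  [/\ arrow_tail a <> arrow_head a, arrow_tail b <> arrow_head b,
      measure_of ip a = measure_of ip b &
      ip a b / (measure_of ip a * measure_of ip b) = 1].

(* [arrow_scale] is a given choice of the point [D], about which nothing is
   assumed beyond the two clauses of its specification and its compatibility
   with [inner]; in particular the uniqueness of [D] is not assumed. *)
Record arrow_space (R : realType) := ArrowSpace {
  point :> Type;
  point_infinite : infinite_set [set: point];
  inner : arrow point -> arrow point -> R;
  inner_ge0 : forall a, 0 <= inner a a;
  inner_eq0 : forall a, inner a a = 0 <-> arrow_tail a = arrow_head a;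
  inner_sym : forall a b, inner a b = inner b a;
  inner_add : forall a b c (h : arrow_head a = arrow_tail b),
    inner (arrow_add h) c = inner a c + inner b c;
  inner_opp : forall a b, inner (arrow_opp a) b = - inner a b;
  arrow_scale : R -> arrow point -> arrow point;
  arrow_scale_degenerate : forall (t : R) (A B : point),
    A = B \/ t = 0 -> arrow_scale t (A, B) = (A, A);
  arrow_scale_proper : forall (t : R) (A B : point), A <> B -> t <> 0 ->
    exists D : point,
      [/\ arrow_scale t (A, B) = (A, D),
          measure_of inner (A, D) = `|t| * measure_of inner (A, B),
          0 < t -> inner (A, B) (A, D) =
            measure_of inner (A, B) * measure_of inner (A, D) &
          t < 0 -> inner (A, B) (A, D) =
            - (measure_of inner (A, B) * measure_of inner (A, D))];
  inner_scale : forall (t : R) a b, inner (arrow_scale t a) b = t * inner a b;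
  inner_rel : forall a b c d, arrow_rel inner a b -> arrow_rel inner c d ->
    inner a c = inner b d;
  arrow_transport : forall A B P : point, A <> B ->
    (exists! K, arrow_rel inner (A, B) (P, K)) /\
    (exists! K, arrow_rel inner (A, B) (K, P))
}.

Definition equipollent {R : realType} {S : arrow_space R} (a b : arrow S) :
  Prop := arrow_rel (@inner R S) a b.

Definition arrow_class {R : realType} {S : arrow_space R} (a : arrow S) :
  set (arrow S) := [set b | equipollent a b].

Record vector {R : realType} (S : arrow_space R) := Vector {
  vector_set :> set (arrow S);
  vector_setP : exists a, vector_set = arrow_class a
}.

Lemma vector_of_subproof {R : realType} {S : arrow_space R} (a : arrow S) :
  exists b, arrow_class a = arrow_class b.
Proof. by exists a. Qed.

Definition vector_of {R : realType} {S : arrow_space R} (a : arrow S) :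
  vector S := Vector (vector_of_subproof a).

Lemma vector_eq {R : realType} {S : arrow_space R} (u v : vector S) :
  vector_set u = vector_set v -> u = v.
Proof.
case: u v => [u hu] [v hv] /= uv; rewrite uv in hu *.
by rewrite (Prop_irrelevance hu hv).
Qed.

Lemma equipollentP {R : realType} {S : arrow_space R} (a b : arrow S) :
  equipollent a b <-> (forall x, inner a x = inner b x).
Proof.
have of_eq (c d : arrow S) :
    (forall x, inner c x = inner d x) -> equipollent c d.
  move=> e.
  have edd : inner c c = inner d d by rewrite e inner_sym e.
  have [hc|hc] := pselect (arrow_tail c = arrow_head c).
    by left; split=> //; apply/inner_eq0; rewrite -edd; apply/inner_eq0.
  have hm : measure_of (@inner R S) c = measure_of (@inner R S) d.
    by rewrite /measure_of edd.
  right; split=> //.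
    by move=> hd; apply: hc; apply/inner_eq0; rewrite edd; apply/inner_eq0.
  rewrite -hm inner_sym -e -expr2 sqr_sqrtr ?inner_ge0// divff//.
  by apply/eqP => /inner_eq0.
split=> [ab x|]; last exact: of_eq.
by apply: inner_rel => //; exact: of_eq.
Qed.

Lemma vector_ofP {R : realType} {S : arrow_space R} (a b : arrow S) :
  vector_of a = vector_of b <-> equipollent a b.
Proof.
split=> [/(congr1 (fun u => vector_set u b)) /= e|/equipollentP ab].
  by rewrite -[equipollent a b]/(arrow_class a b) e; apply/equipollentP.
apply: vector_eq; apply/seteqP; split=> x /= /equipollentP ax;
  apply/equipollentP => y; by rewrite -ax ab.
Qed.

Lemma equipollent_transport {R : realType} {S : arrow_space R} (a : arrow S)
    (P : S) :
  (exists! K, equipollent a (P, K)) /\ (exists! K, equipollent a (K, P)).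
Proof.
case: a => A B; have [<-{B}|nAB] := pselect (A = B); last first.
  exact: arrow_transport.
by split; exists P; split=> [|K [[_ //]|[]//]]; left.
Qed.

(* All the arrows obtained from all the possible choices of the intermediate
   point [P]; [vector_add_subproof] is the well-definedness of the sum. *)
Definition vector_add_set {R : realType} {S : arrow_space R}
    (u v : set (arrow S)) : set (arrow S) :=
  [set x | exists K P L : S, [/\ u (K, P), v (P, L) &
     equipollent (@arrow_add S (K, P) (P, L) erefl) x]].

Lemma vector_add_setE {R : realType} {S : arrow_space R} (a b : arrow S)
    (K P L : S) :
  equipollent (K, P) a -> equipollent (P, L) b ->
  vector_add_set (arrow_class a) (arrow_class b) = arrow_class (K, L).
Proof.
move=> /equipollentP KPa /equipollentP PLb; apply/seteqP; split=> x /=.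
  move=> [K' [P' [L' [/equipollentP ha /equipollentP hb /equipollentP hx]]]].
  apply/equipollentP => y; rewrite -hx inner_add.
  rewrite -[(K, L)]/(@arrow_add S (K, P) (P, L) erefl) inner_add.
  by rewrite KPa PLb ha hb.
by move=> hx; exists K, P, L; split=> //; apply/equipollentP.
Qed.

Lemma vector_add_subproof {R : realType} {S : arrow_space R} (u v : vector S) :
  exists a, vector_add_set u v = arrow_class a.
Proof.
have [a ->] := vector_setP u; have [b ->] := vector_setP v.
have [_ [K [hK _]]] := equipollent_transport a (arrow_head a).
have [[L [hL _]] _] := equipollent_transport b (arrow_head a).
exists (K, L); apply: (@vector_add_setE _ _ _ _ _ (arrow_head a)).
  by apply/equipollentP => x; move/equipollentP : hK => ->.
by apply/equipollentP => x; move/equipollentP : hL => ->.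
Qed.

Definition vector_add {R : realType} {S : arrow_space R} (u v : vector S) :
  vector S := Vector (vector_add_subproof u v).

Lemma vector_addE {R : realType} {S : arrow_space R} (a b : arrow S)
    (K P L : S) :
  equipollent (K, P) a -> equipollent (P, L) b ->
  vector_add (vector_of a) (vector_of b) = vector_of (K, L).
Proof. by move=> ha hb; apply: vector_eq; exact: vector_add_setE ha hb. Qed.

(* All the arrows obtained from all the representatives of [u]. *)
Definition vector_scale_set {R : realType} {S : arrow_space R} (t : R)
    (u : set (arrow S)) : set (arrow S) :=
  [set x | exists2 a, u a & equipollent (arrow_scale t a) x].

Lemma vector_scale_setE {R : realType} {S : arrow_space R} (t : R)
    (a : arrow S) :
  vector_scale_set t (arrow_class a) = arrow_class (arrow_scale t a).
Proof.
apply/seteqP; split=> x /=; last by exists a => //; apply/equipollentP.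
move=> [b /equipollentP ab /equipollentP bx].
by apply/equipollentP => y; rewrite -bx !inner_scale ab.
Qed.

Lemma vector_scale_subproof {R : realType} {S : arrow_space R} (t : R)
    (u : vector S) :
  exists a, vector_scale_set t u = arrow_class a.
Proof.
have [a ->] := vector_setP u.
by exists (arrow_scale t a); exact: vector_scale_setE.
Qed.

Definition vector_scale {R : realType} {S : arrow_space R} (t : R)
  (u : vector S) : vector S := Vector (vector_scale_subproof t u).

Lemma vector_scaleE {R : realType} {S : arrow_space R} (t : R) (a : arrow S) :
  vector_scale t (vector_of a) = vector_of (arrow_scale t a).
Proof. by apply: vector_eq; exact: vector_scale_setE. Qed.

(* Main.v *)
(* A vector is determined by its inner products with all arrows
   ([equipollentP]); these are linear in the scalar by Axiom 2, so both
   identities reduce to the ring laws of the reals. *)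
Require Import Defs.
From mathcomp Require Import all_boot all_order all_algebra.
From mathcomp Require Import boolp classical_sets cardinality reals.

Import Order.TTheory GRing.Theory Num.Theory.
Local Open Scope ring_scope.

(** The functional [inner a] determines the vector of [a] and is linear in the scalar, so (1) is
    associativity in the reals and (2) is distributivity, once [vector_add_of] reads vector sums off
    functionals. *)

Lemma vector_of_eq (R : realType) (S : arrow_space R) (a b : arrow S) :
  (forall x, inner a x = inner b x) -> vector_of a = vector_of b.
Proof. by move=> ab; apply/vector_ofP/equipollentP. Qed.

(** Additivity of [inner] along consecutive arrows makes the functional of a sum the sum of the
    functionals. *)
Lemma vector_add_of (R : realType) (S : arrow_space R) (a b c : arrow S) :
  (forall x, inner c x = inner a x + inner b x) ->
  vector_add (vector_of a) (vector_of b) = vector_of c.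
Proof.
move=> cE; case: a cE => K P cE.
(* With the head [P] of [a] as intermediate point, only [b] has to be moved. *)
have [[L [/equipollentP bL _]] _] := equipollent_transport b P.
rewrite (@vector_addE _ _ _ _ K P L); first last.
- by apply/equipollentP => x; rewrite bL.
- exact/equipollentP.
apply: vector_of_eq => x; rewrite cE bL.
exact: (@inner_add _ S (K, P) (P, L) x erefl).
Qed.

Theorem theorem56 (R : realType) (S : arrow_space R) (A B : S) (s t : R) :
  vector_scale (t * s) (vector_of (A, B)) =
    vector_scale t (vector_of (arrow_scale s (A, B))) /\
  vector_scale (t + s) (vector_of (A, B)) =
    vector_add (vector_scale t (vector_of (A, B)))
               (vector_scale s (vector_of (A, B))).
Proof.
rewrite !vector_scaleE; split.
  by apply: vector_of_eq => x; rewrite !inner_scale mulrA.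
by apply/esym/vector_add_of => x; rewrite !inner_scale mulrDl.
Qed.
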